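(* Let $\Sigma$ and $\Sigma'$ be seeds. Then $\mathcal A(\Sigma)\cong\mathcal A(\Sigma')$ in the category $\mathbf{Clus}$ of rooted cluster algebras if and only if $\Sigma\cong\Sigma'$ in the category $\mathbf{Seed}$ of seeds.
   Context: **Seeds and cluster algebras.** A seed $\Sigma=(X,X_{fr},\widetilde B)$ consists of disjoint finite sets $X=\{x_1,\dots,x_n\}$ (the cluster; its elements are exchangeable variables; $X=\emptyset$ is allowed) and $X_{fr}=\{x_{n+1},\dots,x_{n+m}\}$ (frozen variables) such that the extended cluster $\widetilde X=X\cup X_{fr}$ is algebraically independent over $\mathbb Q$ and generates the field $\mathbb F(\Sigma)=\mathbb Q(\widetilde X)$, together with an integer matrix $\widetilde B=(b_{xy})_{x\in X,y\in\widetilde X}$ whose principal part $B=(b_{xy})_{x,y\in X}$ is totally sign-skew-symmetric: every matrix obtained from it by finitely many mutations is sign-skew-symmetric (for all $x,y$, either $b_{xy}=b_{yx}=0$ or $b_{xy}b_{yx}<0$). For $x\in X$ the mutation $\mu_x(\Sigma)$ replaces $x$ by $\mu_x(x)=x^{-1}\bigl(\prod_{b_{xt}>0}t^{b_{xt}}+\prod_{b_{xt}<0}t^{-b_{xt}}\bigr)$ ($t\in\widetilde X$), fixes the other variables ($\mu_x(y)=y$ for $y\ne x$), and replaces $\widetilde B$ by the matrix with entries $-b_{yz}$ if $y=x$ or $z=x$, and $b_{yz}+\frac{|b_{yx}|b_{xz}+b_{yx}|b_{xz}|}{2}$ otherwise (relabelling $x$ as $\mu_x(x)$). $\mathcal A(\Sigma)$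 is the $\mathbb Z[X_{fr}]$-subalgebra of $\mathbb F(\Sigma)$ generated by all cluster variables in all seeds obtained from $\Sigma$ by iterated mutations; together with its initial seed $\Sigma$ it is called a rooted cluster algebra. **Category Clus.** Objects are rooted cluster algebras, morphisms are rooted cluster morphisms. A sequence $(y_1,\dots,y_l)$ is $\Sigma$-admissible if $y_1$ is exchangeable in $\Sigma$ and $y_i$ is exchangeable in $\mu_{y_{i-1}}\cdots\mu_{y_1}(\Sigma)$ for $i\ge2$; it is $(f,\Sigma,\Sigma')$-biadmissible if moreover $(f(y_1),\dots,f(y_l))$ is $\Sigma'$-admissible. A rooted cluster morphism $f:\mathcal A(\Sigma)\to\mathcal A(\Sigma')$ is a unital ring homomorphism with (CM1) $f(\widetilde X)\subseteq\widetilde X'\sqcup\mathbb Z$; (CM2) $f(X)\subseteq X'\sqcup\mathbb Z$; (CM3) $f(\mu_{y_s}\cdots\mu_{y_1}(y))=\mu_{f(y_s)}\cdots\mu_{f(y_1)}(f(y))$ for every $(f,\Sigma,\Sigma')$-biadmissible sequence $(y_1,\dots,y_s)$ and every $y\in\widetilde X$ (mutations fix integers). An isomorphism in $\mathbf{Clus}$ is a rooted cluster morphism that is both injective and surjective. **Category Seed.** Objects are seeds, morphisms are seed homomorphisms. Pairs $(x,y),(z,w)$ with $x,z\in X$, $y,w\in\widetilde X$ are adjacent if $b_{xz}\neq0$ or $x=z$. A seed homomorphism $f:\Sigma\to\Sigma'$ is a map $f:\widetilde X\to\widetilde X'$ with $f(X)\subseteq X'$ such that for all adjacent pairs $(x,y),(z,w)$: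 $(b'_{f(x)f(y)}b_{xy})(b'_{f(z)f(w)}b_{zw})\ge0$ and $|b'_{f(x)f(y)}|\ge|b_{xy}|$. It is a seed isomorphism if it induces bijections $X\to X'$ and $\widetilde X\to\widetilde X'$ and $|b_{xy}|=|b'_{f(x)f(y)}|$ for all $x\in X,y\in\widetilde X$; $\Sigma\cong\Sigma'$ means that a seed isomorphism exists. *)

(* Defs.v *)
From HB Require Import structures.
From mathcomp Require Import all_boot all_order all_algebra.
From mathcomp Require Import boolp.
From mathcomp Require Import mpoly.

Set Implicit Arguments.
Unset Strict Implicit.
Unset Printing Implicit Defensive.

Import Order.TTheory GRing.Theory Num.Theory.
Local Open Scope ring_scope.

(* Variables are indexed: 'I_n indexes X, embedded by lshift m into 'I_(n + m),
   which indexes the extended cluster.  An exchange matrix has its rows indexed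
   by X and its columns by either X or the extended cluster; [emb] says which
   columns are the exchangeable ones, so that one formula covers both.        *)

Section MatrixMutation.
Variables (n N : nat) (emb : 'I_n -> 'I_N).

(* The division is exact: |a| * b + a * |b| is always even. *)
Definition mutate_mx (B : 'M[int]_(n, N)) (x : 'I_n) : 'M[int]_(n, N) :=
  \matrix_(y, z)
    if (y == x) || (z == emb x) then - B y z
    else B y z +
      ((`|B y (emb x)| * B x z + B y (emb x) * `|B x z|) %/ 2)%Z.

End MatrixMutation.

Definition sign_skew_symmetric n (B : 'M[int]_n) : Prop :=
  forall x y, (B x y = 0 /\ B y x = 0) \/ B x y * B y x < 0.

Definition totally_sign_skew_symmetric n (B : 'M[int]_n) : Prop :=
  forall s : seq 'I_n, sign_skew_symmetric (foldl (mutate_mx id) B s).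

(* As a condition on the family v it includes injectivity, whence X and X_fr
   are disjoint.                                                              *)
Definition alg_independent (F : fieldType) N (v : 'I_N -> F) : Prop :=
  forall p : {mpoly rat[N]}, mmap ratr v p = 0 -> p = 0.

Definition generates_field (F : fieldType) N (v : 'I_N -> F) : Prop :=
  forall z : F, exists p q : {mpoly rat[N]},
    mmap ratr v q != 0 /\ z = mmap ratr v p / mmap ratr v q.

Record seed_data (F : fieldType) (n m : nat) := SeedData {
  var : 'I_(n + m) -> F;
  exmx : 'M[int]_(n, n + m)
}.

Section Mutation.
Variables (F : fieldType) (n m : nat).
Implicit Types (D : seed_data F n m) (x : 'I_n) (y z : F).

Definition ext_cluster D : seq F := codom (var D).
Definition cluster D : seq F := codom (fun x => var D (lshift m x)).

Definition exchange D x : F :=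
  (var D (lshift m x))^-1 *
  (\prod_(t | 0 < exmx D x t) var D t ^ exmx D x t +
   \prod_(t | exmx D x t < 0) var D t ^ (- exmx D x t)).

Definition mutate_at D x : seed_data F n m :=
  SeedData (fun t => if t == lshift m x then exchange D x else var D t)
           (mutate_mx (lshift m) (exmx D) x).

Definition exch_index D y : option 'I_n := [pick x | var D (lshift m x) == y].

(* Mutation in the direction of an exchangeable variable, given as a field
   element; the None branches are junk, excluded by admissibility.            *)
Definition mutate D y : seed_data F n m :=
  if exch_index D y is Some x then mutate_at D x else D.

Definition mutate_var D y z : F :=
  if exch_index D y is Some x then (if z == y then exchange D x else z) else z.

Fixpoint admissible D (ys : seq F) : bool :=
  if ys is y :: ys' then (y \in cluster D) && admissible (mutate D y) ys'
  else true.

(* mutate_vars D [:: y_1; ...; y_s] z is mu_{y_s} ... mu_{y_1} (z), where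
   mu_{y_i} is taken in the seed mu_{y_(i-1)} ... mu_{y_1} (D).               *)
Fixpoint mutate_vars D (ys : seq F) z : F :=
  if ys is y :: ys' then mutate_vars (mutate D y) ys' (mutate_var D y z)
  else z.

(* The Z[X_fr]-subalgebra generated by the cluster variables is the subring
   generated by these together with the frozen variables.                     *)
Inductive in_cluster_algebra D : F -> Prop :=
| ica_frozen (j : 'I_m) : in_cluster_algebra D (var D (rshift n j))
| ica_cluster (s : seq 'I_n) x :
    in_cluster_algebra D (var (foldl mutate_at D s) (lshift m x))
| ica_one : in_cluster_algebra D 1
| ica_sub z z' : in_cluster_algebra D z -> in_cluster_algebra D z' ->
    in_cluster_algebra D (z - z')
| ica_mul z z' : in_cluster_algebra D z -> in_cluster_algebra D z' ->
    in_cluster_algebra D (z * z').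

End Mutation.

Record seed := Seed {
  rank : nat;
  nfrozen : nat;
  ambient : fieldType;
  data :> seed_data ambient rank nfrozen;
  ambient_pchar0 : [pchar ambient] =i pred0;
  seed_independent : alg_independent (var data);
  seed_generates : generates_field (var data);
  seed_tsss : totally_sign_skew_symmetric (lsubmx (exmx data))
}.

Definition cluster_algebra_pred (S : seed) : {pred ambient S} :=
  fun z => `[< in_cluster_algebra S z >].
Arguments cluster_algebra_pred : clear implicits.

Fact cluster_algebra_subring_closed S : subring_closed (cluster_algebra_pred S).
Proof.
split; first by apply/asboolP; apply: ica_one.
- by move=> u v /asboolP hu /asboolP hv; apply/asboolP; apply: ica_sub.
- by move=> u v /asboolP hu /asboolP hv; apply/asboolP; apply: ica_mul.
Qed.

HB.instance Definition _ (S : seed) :=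
  GRing.isSubringClosed.Build (ambient S) (cluster_algebra_pred S)
    (cluster_algebra_subring_closed S).

Record cluster_algebra (S : seed) := ClusterAlgebra {
  ca_val : ambient S;
  _ : ca_val \in cluster_algebra_pred S
}.

HB.instance Definition _ (S : seed) := [isSub for @ca_val S].
HB.instance Definition _ (S : seed) := [Choice of cluster_algebra S by <:].
HB.instance Definition _ (S : seed) :=
  [SubChoice_isSubComNzRing of cluster_algebra S by <:].

Lemma in_cluster_algebra_mutate_vars (S : seed) (ys : seq (ambient S)) y :
  y \in ext_cluster S -> mutate_vars S ys y \in cluster_algebra_pred S.
Proof.
move=> hy; apply/asboolP.
have {hy} : y \in codom (var (foldl (@mutate_at _ _ _) S [::])) by [].
have : forall s j, var (foldl (@mutate_at _ _ _) S s) (rshift _ j)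
                   = var S (rshift (rank S) j).
  elim/last_ind => [//|s x IH] j.
  by rewrite -cats1 foldl_cat /= eq_rlshift IH.
move=> hfr; rewrite -[X in mutate_vars X]/(foldl (@mutate_at _ _ _) S [::]).
elim: ys [::] y => [|y0 ys IH] s y /=.
  case/codomP=> t ->; case: (split_ordP t) => i ->.
    exact: ica_cluster.
  by rewrite hfr; apply: ica_frozen.
move=> hy; rewrite /mutate /mutate_var /exch_index.
case: pickP => [x /eqP hx|_]; last exact: IH.
rewrite -[mutate_at _ x]/(foldl (@mutate_at _ _ _) (foldl (@mutate_at _ _ _) S s) [:: x]).
rewrite -foldl_cat; apply: IH; rewrite foldl_cat /=.
case: (eqVneq y y0) => [_|ne].
  by apply/codomP; exists (lshift _ x); rewrite /= eqxx.
case/codomP: hy => t ht; apply/codomP; exists t => /=.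
by case: eqP => // et; case/eqP: ne; rewrite ht et hx.
Qed.

Definition in_or_int (F : fieldType) (A : seq F) (z : F) : Prop :=
  z \in A \/ exists k : int, z = k%:~R.

Section Clus.
Variables S S' : seed.
Implicit Type f : {rmorphism cluster_algebra S -> cluster_algebra S'}.

Definition biadmissible f (ys : seq (cluster_algebra S)) : bool :=
  admissible S (map val ys) && admissible S' (map (fun y => val (f y)) ys).

(* In CM3, [a] is the mutated variable as an element of the algebra; it exists
   by in_cluster_algebra_mutate_vars.                                         *)
Record rooted_cluster_morphism f : Prop := RootedClusterMorphism {
  CM1 : forall x, val x \in ext_cluster S ->
    in_or_int (ext_cluster S') (val (f x));
  CM2 : forall x, val x \in cluster S -> in_or_int (cluster S') (val (f x));
  CM3 : forall (ys : seq (cluster_algebra S)) (y a : cluster_algebra S),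
    biadmissible f ys -> val y \in ext_cluster S ->
    val a = mutate_vars S (map val ys) (val y) ->
    val (f a) = mutate_vars S' (map (fun y => val (f y)) ys) (val (f y))
}.

Definition Clus_iso : Prop :=
  exists f : {rmorphism cluster_algebra S -> cluster_algebra S'},
    [/\ rooted_cluster_morphism f, injective f
      & forall b, exists a, f a = b].

End Clus.

Section SeedCat.
Variables S S' : seed.

(* A map f of extended clusters with f(X) included in X' is given on indices,
   together with the map g that it induces from X to X'.                      *)
Record seed_hom := SeedHom {
  shom_ext : 'I_(rank S + nfrozen S) -> 'I_(rank S' + nfrozen S');
  shom_exch : 'I_(rank S) -> 'I_(rank S');
  shom_extE : forall x,
    shom_ext (lshift (nfrozen S) x) = lshift (nfrozen S') (shom_exch x);
  shom_adjacent : forall x y z w,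
    exmx S x (lshift (nfrozen S) z) != 0 \/ x = z ->
    0 <= (exmx S' (shom_exch x) (shom_ext y) * exmx S x y) *
         (exmx S' (shom_exch z) (shom_ext w) * exmx S z w) /\
    `|exmx S x y| <= `|exmx S' (shom_exch x) (shom_ext y)|
}.

Definition is_seed_iso (f : seed_hom) : Prop :=
  [/\ bijective (shom_exch f), bijective (shom_ext f)
    & forall x y, `|exmx S x y| = `|exmx S' (shom_exch f x) (shom_ext f y)|].

Definition Seed_iso : Prop := exists f : seed_hom, is_seed_iso f.

End SeedCat.

(* Main.v *)
(* A seed isomorphism induces an isomorphism of the ambient fields, because each
   field is the field of rational functions in its extended cluster.  The two
   exchange matrices agree up to a sign that is constant on the connected
   components of the principal part; mutation preserves this relation, and the
   exchange binomials do not see the sign, so the field isomorphism commutes with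
   all mutations and restricts to the cluster algebras.

   Conversely, a bijective rooted cluster morphism sends variables to variables
   (a variable is not an integer), hence is the restriction of a field
   homomorphism, so it is onto the extended cluster: a missing variable would be
   a rational function of the others.  No frozen y becomes exchangeable: all
   cluster variables are subtraction-free in the initial ones and remain finite
   and positive where y vanishes and the other variables are 1, so that the
   exchange binomial of the image of y, which does not involve it, cannot be y
   times an element of the algebra.  Finally CM3 for a single mutation identifies
   the exchange binomials, hence each row up to a sign, and sign-skew-symmetry
   forces equal signs on adjacent rows. *)

From HB Require Import structures.
From mathcomp Require Import all_boot all_order all_algebra.
From mathcomp Require Import boolp mpoly ring zify.
Require Import Defs.

Set Implicit Arguments.
Unset Strict Implicit.
Unset Printing Implicit Defensive.

Import Order.TTheory GRing.Theory Num.Theory.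
Local Open Scope ring_scope.

(** * Evaluation of rational polynomials in characteristic zero *)

Lemma mpoly_rmorph_ext N (R : comUnitRingType)
    (h k : {rmorphism {mpoly rat[N]} -> R}) :
  (forall i, h 'X_i = k 'X_i) -> h =1 k.
Proof.
move=> hk; elim/mpolyind => [|c m p _ _ IH]; first by rewrite !rmorph0.
rewrite !rmorphD IH -mul_mpolyC !rmorphM; congr (_ * _ + _).
  have/= -> := fmorph_eq_rat (h \o @mpolyC N rat) c.
  by have/= -> := fmorph_eq_rat (k \o @mpolyC N rat) c.
rewrite mpolyXE_id !rmorph_prod; apply: eq_bigr => i _.
by rewrite !rmorphXn hk.
Qed.

Section RatInPchar0.
Variables (F : fieldType) (ch : [pchar F] =i pred0).

Lemma pchar0_intr_eq0 (k : int) : (k%:~R == 0 :> F) = (k == 0).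
Proof.
have natr0 : forall n, (n%:R == 0 :> F) = (n == 0)%N by apply/pcharf0P.
by case: k => n; rewrite ?NegzE ?mulrNz ?oppr_eq0 -pmulrn natr0.
Qed.

Let denq_neq0 x : (denq x)%:~R != 0 :> F.
Proof. by rewrite pchar0_intr_eq0 denq_eq0. Qed.

Let intr_rat_inj : injective (fun k : int => k%:~R : rat).
Proof. exact: intr_inj. Qed.

(* The library proves these two facts over a numFieldType only. *)
Fact pchar0_ratr_zmod_morphism : zmod_morphism (@ratr F).
Proof.
move=> x y; apply: (canLR (mulfK (denq_neq0 _))); apply: (mulIf (denq_neq0 x)).
rewrite mulrAC mulrBl divfK // mulrAC -!rmorphM.
apply: (mulIf (denq_neq0 y)); rewrite mulrAC mulrBl divfK // -!(rmorphM, rmorphB).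
congr _%:~R; apply: intr_rat_inj.
rewrite !(rmorphM, rmorphB) /= [_ - _]lock /= -lock !numqE.
by rewrite (mulrAC y) -!mulrBl -mulrA mulrAC !mulrA.
Qed.

Fact pchar0_ratr_monoid_morphism : monoid_morphism (@ratr F).
Proof.
split=> [|x y]; first by rewrite /ratr divr1.
have -> : ratr (x * y) = (numq x * numq y)%:~R / (denq x * denq y)%:~R :> F.
  apply/eqP; rewrite eqr_div ?rmorphM ?mulf_neq0 ?denq_neq0 //.
  rewrite -!rmorphM /=; apply/eqP; congr _%:~R; apply: intr_rat_inj.
  rewrite !rmorphM [x * y]lock /= !numqE -lock; ring.
by rewrite !rmorphM invfM /ratr; ring.
Qed.

Definition pchar0_ratr : {rmorphism rat -> F} :=
  HB.pack (@ratr F) (GRing.isZmodMorphism.Build rat F _ pchar0_ratr_zmod_morphism)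
    (GRing.isMonoidMorphism.Build rat F _ pchar0_ratr_monoid_morphism).

(** Convertible to [mmap ratr v], but carrying the ring morphism structure that [ratr] has in
    characteristic zero. *)
Definition peval N (v : 'I_N -> F) : {rmorphism {mpoly rat[N]} -> F} :=
  mmap pchar0_ratr v.

Section Peval.
Variable N : nat.
Implicit Types (v : 'I_N -> F) (p q : {mpoly rat[N]}).

Lemma pevalE v p : peval v p = mmap ratr v p.
Proof. by []. Qed.

Lemma pevalX v m : peval v 'X_[m] = \prod_i v i ^+ m i.
Proof. exact: (mmapX v pchar0_ratr). Qed.

Lemma pevalXU v i : peval v 'X_i = v i.
Proof. by rewrite [LHS](mmapX v pchar0_ratr) mmap1U. Qed.

Lemma pevalC v c : peval v c%:MP = ratr c.
Proof. exact: (mmapC v pchar0_ratr). Qed.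

Lemma eq_peval v w : v =1 w -> peval v =1 peval w.
Proof. by move=> /funext ->. Qed.

End Peval.

Lemma rmorph_peval N (R : comNzRingType) (h : {rmorphism {mpoly rat[N]} -> R})
    (k : {rmorphism R -> F}) p :
  k (h p) = peval (fun t => k (h 'X_t)) p.
Proof.
by apply: (mpoly_rmorph_ext (h := k \o h)) => i; rewrite pevalXU.
Qed.

End RatInPchar0.

Lemma fmorph_peval (F F' : fieldType) (ch : [pchar F] =i pred0)
    (ch' : [pchar F'] =i pred0) N (phi : {rmorphism F -> F'}) (u : 'I_N -> F) p :
  phi (peval ch u p) = peval ch' (phi \o u) p.
Proof. by rewrite (rmorph_peval ch' (peval ch u)); apply: eq_peval => t; rewrite pevalXU. Qed.

Definition mrename M N (e : 'I_M -> 'I_N) : {rmorphism {mpoly rat[M]} -> {mpoly rat[N]}} :=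
  mmap (@mpolyC N rat) (fun t => 'X_(e t)).

Lemma mrenameX M N (e : 'I_M -> 'I_N) t : mrename e 'X_t = 'X_(e t).
Proof. by rewrite /mrename /= mmapX mmap1U. Qed.

Lemma peval_mrename M N (F : fieldType) (ch : [pchar F] =i pred0) (v : 'I_N -> F)
    (e : 'I_M -> 'I_N) p : peval ch v (mrename e p) = peval ch (v \o e) p.
Proof.
by rewrite (rmorph_peval ch (mrename e)); apply: eq_peval => t; rewrite mrenameX pevalXU.
Qed.

(** * Algebraically independent families and the exchange substitution *)

Definition subst_at N (R : Type) (u : 'I_N -> R) x c t := if t == x then c else u t.

Section Independence.
Variables (F : fieldType) (ch : [pchar F] =i pred0) (N : nat) (v : 'I_N -> F).
Hypothesis indep : alg_independent v.
Implicit Types p q : {mpoly rat[N]}.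

Lemma peval_inj : injective (peval ch v).
Proof.
move=> p q /eqP; rewrite -subr_eq0 -rmorphB => /eqP /indep /eqP.
by rewrite subr_eq0 => /eqP.
Qed.

Lemma peval_neq0 p : p != 0 -> peval ch v p != 0.
Proof. by apply: contraNneq => /indep ->. Qed.

Lemma alg_independent_var_neq_int i (k : int) : v i <> k%:~R.
Proof.
rewrite -(pevalXU ch v i) -(rmorph_int (peval ch v)) => /peval_inj.
move/(congr1 (peval ch (fun=> (k + 1)%:~R))); rewrite pevalXU rmorph_int => /eqP.
by rewrite intrD -subr_eq0 addrAC subrr add0r oner_eq0.
Qed.

Lemma alg_independent_var_neq0 i : v i != 0.
Proof. by apply/eqP; exact: (@alg_independent_var_neq_int i 0). Qed.

Lemma alg_independent_var_inj : injective v.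
Proof.
move=> i j; rewrite -2!(pevalXU ch v) => /peval_inj.
move/(congr1 (peval ch (fun t => (t == i)%:R))); rewrite !pevalXU eqxx.
by case: eqP => // _ /eqP; rewrite oner_eq0.
Qed.

(** Renaming variables along an injection has a left inverse, which sends the variables outside the
    image to 0. *)
Lemma alg_independent_comp M (e : 'I_M -> 'I_N) :
  injective e -> alg_independent (v \o e).
Proof.
move=> e_inj p vp0.
pose back : {rmorphism {mpoly rat[N]} -> {mpoly rat[M]}} :=
  mmap (@mpolyC M rat) (fun s => if [pick t | e t == s] is Some t then 'X_t else 0).
have renameK : cancel (mrename e) back.
  apply: (mpoly_rmorph_ext (h := back \o mrename e) (k := idfun)) => t /=.
  rewrite mrenameX /back /= mmapX mmap1U; case: pickP => [t' /eqP/e_inj -> //|/(_ t)].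
  by rewrite eqxx.
apply: (can_inj renameK); rewrite rmorph0; apply: indep; rewrite -(pevalE ch).
by rewrite peval_mrename.
Qed.

(** Independence of [v] makes the image of a fraction independent of its representation;
    independence of [w] keeps the denominators nonzero. *)
Lemma generic_field_hom (F' : fieldType) (ch' : [pchar F'] =i pred0) (w : 'I_N -> F') :
  alg_independent w -> generates_field v ->
  exists phi : {rmorphism F -> F'}, forall i, phi (v i) = w i.
Proof.
move=> w_indep gen.
have /choice[pq pqP] : forall z, exists pq : {mpoly rat[N]} * {mpoly rat[N]},
    peval ch v pq.2 != 0 /\ z = peval ch v pq.1 / peval ch v pq.2.
  by move=> z; have [p [q pqP]] := gen z; exists (p, q).
pose phi z := peval ch' w (pq z).1 / peval ch' w (pq z).2.
have w_neq0 q : peval ch v q != 0 -> peval ch' w q != 0.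
  by apply: contraNneq => /w_indep ->; rewrite rmorph0.
have phiE p q : peval ch v q != 0 ->
    phi (peval ch v p / peval ch v q) = peval ch' w p / peval ch' w q.
  set z := _ / _ => q_neq0; have [zq_neq0 /eqP] := pqP z.
  rewrite {1}/z eqr_div // => /eqP; rewrite -!rmorphM => /peval_inj eq_pq.
  by apply/eqP; rewrite eqr_div ?w_neq0 // -!rmorphM eq_pq.
have phi_zmod : zmod_morphism phi.
  move=> y z; have [qy ->] := pqP y; have [qz ->] := pqP z.
  have subf_div (K : fieldType) (a b c d : K) : b != 0 -> d != 0 ->
      a / b - c / d = (a * d - c * b) / (b * d) by move=> ? ?; field; apply/andP.
  rewrite subf_div // -!rmorphM -rmorphB !phiE ?rmorphM ?mulf_neq0 //.
  by rewrite subf_div ?w_neq0 // rmorphB !rmorphM.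
have phi_monoid : monoid_morphism phi.
  split=> [|y z].
    by have := phiE 1 1; rewrite !rmorph1 !divr1 oner_eq0; apply.
  have [qy ->] := pqP y; have [qz ->] := pqP z.
  by rewrite mulf_div -!rmorphM !phiE ?rmorphM ?mulf_neq0 // mulf_div.
pose phiR : {rmorphism F -> F'} :=
  HB.pack phi (GRing.isZmodMorphism.Build F F' phi phi_zmod)
    (GRing.isMonoidMorphism.Build F F' phi phi_monoid).
exists phiR => i; rewrite /phiR /=.
by have := phiE 'X_i 1; rewrite !rmorph1 !divr1 oner_eq0 !pevalXU; apply.
Qed.

Section ExchangeIndependence.
Variables (x : 'I_N) (M : {mpoly rat[N]}).
Let sw (u : 'I_N -> F) := subst_at u x ((u x)^-1 * peval ch u M).

(** One exponent and one polynomial serve every [u], so the identity can be used at [v] and again at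
    the exchanged family. *)
Let clear_denominators p : exists d (P : {mpoly rat[N]}), forall u,
  u x != 0 -> peval ch u P = u x ^+ d * peval ch (sw u) p.
Proof.
elim/mpolyind: p => [|c m p _ _ [d [P IH]]].
  by exists 0%N, 0 => u _; rewrite !rmorph0 mulr0.
(* Substitution puts [u x ^+ m x] into the denominator of the new monomial, so the exponent
   [d + m x] clears both summands. *)
exists (d + m x)%N,
  ('X_x ^+ d * (c%:MP * (M ^+ m x * \prod_(t | t != x) 'X_t ^+ m t)) + 'X_x ^+ m x * P).
move=> u ux; rewrite -mul_mpolyC !(rmorphD, rmorphM, rmorphXn) IH // rmorph_prod.
rewrite !pevalXU !pevalC pevalX exprD mulrDr [in RHS](bigD1 x) //.
have -> : sw u x = (u x)^-1 * peval ch u M by rewrite /sw /subst_at eqxx.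
rewrite exprMn exprVn.
have -> : \prod_(i | i != x) sw u i ^+ m i = \prod_(t | t != x) peval ch u ('X_t ^+ m t).
  by apply: eq_bigr => t /negbTE tx; rewrite rmorphXn pevalXU /sw /subst_at tx.
have ux' : u x ^+ m x != 0 by rewrite expf_neq0.
by move: (u x ^+ m x) (\prod_(_ | _) _) ux' => y z y_neq0 /=; field.
Qed.

(* The exchange is involutive, and a relation between the new variables becomes,
   after clearing denominators, a polynomial identity; this identity can be
   evaluated at the new variables, where it is a relation between the old ones. *)
Lemma alg_independent_exchange :
  (forall c, peval ch (subst_at v x c) M = peval ch v M) -> M != 0 ->
  alg_independent (subst_at v x ((v x)^-1 * peval ch v M)).
Proof.
move=> M_x M_neq0 p; have [d [P PE]] := clear_denominators p.
have vx := alg_independent_var_neq0 x; have vM := peval_neq0 M_neq0.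
have svx : sw v x != 0 by rewrite /sw /subst_at eqxx mulf_neq0 ?invr_eq0.
move: (PE v vx); rewrite -(pevalE ch) => /[swap] ->; rewrite mulr0 => P0.
have P_eq0 : P = 0 by exact: indep.
move: (PE _ svx); rewrite P_eq0 rmorph0 => /esym/eqP.
rewrite mulf_eq0 expf_eq0 (negbTE svx) andbF /= => /eqP p0.
apply: indep; rewrite -(pevalE ch) -p0; apply: eq_peval => t.
rewrite {1}/sw M_x /sw /subst_at eqxx; case: eqVneq => // ->.
by field; rewrite vx vM.
Qed.

End ExchangeIndependence.

End Independence.

(** * Exchange binomials *)

Section ExchangePolynomial.
Variable N : nat.
Implicit Types b c : 'I_N -> int.

Definition pos_mnm b : 'X_{1..N} :=
  [multinom if (0 < b t)%R then `|b t|%N else 0%N | t < N].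

Definition exch_poly b : {mpoly rat[N]} :=
  'X_[pos_mnm b] + 'X_[pos_mnm (fun t => - b t)].

Lemma exch_polyN b : exch_poly (fun t => - b t) = exch_poly b.
Proof.
rewrite /exch_poly addrC; congr ('X_[pos_mnm _] + _).
by apply/funext => t; rewrite opprK.
Qed.

Lemma pos_mnm_inj b c :
  pos_mnm b = pos_mnm c -> pos_mnm (fun t => - b t) = pos_mnm (fun t => - c t) ->
  b =1 c.
Proof.
move=> /mnmP bc /mnmP Nbc t; move: (bc t) (Nbc t); rewrite !mnmE.
by case: ifP; case: ifP; case: ifP; case: ifP; lia.
Qed.

(** The two monomials are determined up to order, and swapping them amounts to negating the row. *)
Lemma exch_poly_inj b c : exch_poly b = exch_poly c -> b =1 c \/ b =1 (fun t => - c t).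
Proof.
move=> /mpolyP eq_bc; have X_inj (k l : 'X_{1..N}) : 'X_[k] = 'X_[l] :> {mpoly rat[N]} -> k = l.
  move=> /mpolyP/(_ k); rewrite !mcoeffX eqxx; case: eqP => [->//|_ /eqP].
  by rewrite oner_eq0.
have [bc|nbc] := eqVneq (pos_mnm b) (pos_mnm c).
  left; apply: pos_mnm_inj => //; apply: X_inj; apply/mpolyP => k.
  by move: (eq_bc k); rewrite /exch_poly bc !mcoeffD => /addrI.
right; have bNc : pos_mnm b = pos_mnm (fun t => - c t).
  move: (eq_bc (pos_mnm b)); rewrite /exch_poly !mcoeffD !mcoeffX eqxx.
  rewrite [pos_mnm c == _]eq_sym (negbTE nbc) add0r.
  by case: (eqVneq (pos_mnm (fun t => - c t))) => [->//|_]; case: eqP.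
apply: pos_mnm_inj => //; apply: X_inj; apply/mpolyP => k.
move: (eq_bc k); rewrite /exch_poly bNc !mcoeffD addrC => /addIr ->.
by congr ('X_[pos_mnm _]@_k); apply/funext => t; rewrite opprK.
Qed.

Section Evaluation.
Variables (F : fieldType) (ch : [pchar F] =i pred0).
Implicit Type u : 'I_N -> F.

Lemma peval_pos_mnm u b : peval ch u 'X_[pos_mnm b] = \prod_(t | 0 < b t) u t ^ b t.
Proof.
rewrite pevalX [RHS]big_mkcond; apply: eq_bigr => t _; rewrite mnmE.
by case: ltrP => // bt; rewrite -{2}[b t]gez0_abs ?ltW.
Qed.

Lemma peval_exch_poly u b : peval ch u (exch_poly b) =
  \prod_(t | 0 < b t) u t ^ b t + \prod_(t | b t < 0) u t ^ (- b t).
Proof.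
rewrite rmorphD !peval_pos_mnm; congr (_ + _).
by apply: eq_bigl => t; rewrite oppr_gt0.
Qed.

Lemma peval_exch_poly_subst u x (a : F) b : b x = 0 ->
  peval ch (subst_at u x a) (exch_poly b) = peval ch u (exch_poly b).
Proof.
move=> bx; rewrite !peval_exch_poly; congr (_ + _); apply: eq_bigr => t;
by rewrite /subst_at; case: eqP => // ->; rewrite bx ltxx.
Qed.

End Evaluation.

(** The value at the point with all coordinates 1 is 2. *)
Lemma exch_poly_neq0 b : exch_poly b != 0.
Proof.
apply/eqP => /(congr1 (peval (@pchar_num rat) (fun=> 1))); apply/eqP.
rewrite peval_exch_poly rmorph0 !big1 // => t _; exact: exp1rz.
Qed.

End ExchangePolynomial.

Lemma peval_exch_poly_reindex N N' (F : fieldType) (ch : [pchar F] =i pred0)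
    (e : 'I_N -> 'I_N') (u : 'I_N' -> F) (b : 'I_N' -> int) : bijective e ->
  peval ch u (exch_poly b) = peval ch (u \o e) (exch_poly (b \o e)).
Proof.
by move=> e_bij; rewrite !peval_exch_poly; congr (_ + _);
  rewrite (reindex e) //; exact: onW_bij.
Qed.

Lemma exchangeE (F : fieldType) (ch : [pchar F] =i pred0) n m (D : seed_data F n m) x :
  exchange D x =
  (var D (lshift m x))^-1 * peval ch (var D) (exch_poly (exmx D x)).
Proof. by rewrite peval_exch_poly. Qed.

(** * Seed conditions preserved by mutation *)

Section Nondegenerate.
Variables (F : fieldType) (ch : [pchar F] =i pred0) (n m : nat).
Implicit Types D : seed_data F n m.

Definition nondegenerate D :=
  alg_independent (var D) /\ totally_sign_skew_symmetric (lsubmx (exmx D)).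

Lemma tsss_sign_skew D (x y : 'I_n) :
  totally_sign_skew_symmetric (lsubmx (exmx D)) ->
  let b z t := exmx D z (lshift m t) in
  (b x y = 0 /\ b y x = 0) \/ b x y * b y x < 0.
Proof. by move=> /(_ [::] x y); rewrite /= !mxE. Qed.

Lemma tsss_diag D x :
  totally_sign_skew_symmetric (lsubmx (exmx D)) -> exmx D x (lshift m x) = 0.
Proof.
by move=> /(tsss_sign_skew x x) /= [[]//|]; rewrite -expr2 ltNge sqr_ge0.
Qed.

Lemma lsubmx_mutate_mx (B : 'M[int]_(n, n + m)) x :
  lsubmx (mutate_mx (lshift m) B x) = mutate_mx id (lsubmx B) x.
Proof. by apply/matrixP => y z; rewrite !mxE (inj_eq (@lshift_inj _ _)). Qed.

(** The principal part has zero diagonal, so the binomial does not involve the exchanged variable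
    and [alg_independent_exchange] applies. *)
Lemma nondegenerate_mutate_at D x : nondegenerate D -> nondegenerate (mutate_at D x).
Proof.
move=> [indep tsss]; split=> /=; last by move=> s; rewrite lsubmx_mutate_mx; exact: (tsss (x :: s)).
rewrite (exchangeE ch); apply: alg_independent_exchange => //; last exact: exch_poly_neq0.
by move=> c; rewrite peval_exch_poly_subst // tsss_diag.
Qed.

Lemma nondegenerate_foldl D s :
  nondegenerate D -> nondegenerate (foldl (@mutate_at F n m) D s).
Proof. by elim: s D => //= x s IH D /(nondegenerate_mutate_at x)/IH. Qed.

Lemma exch_index_var D x : nondegenerate D -> exch_index D (var D (lshift m x)) = Some x.
Proof.
move=> [indep _]; rewrite /exch_index; case: pickP => [y|/(_ x)]; last by rewrite eqxx.
by rewrite (inj_eq (alg_independent_var_inj ch indep)) (inj_eq (@lshift_inj _ _)) => /eqP ->.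
Qed.

End Nondegenerate.

(** * From seed isomorphisms to isomorphisms of rooted cluster algebras *)

(** Euclidean division by 2 commutes with negation only on even numbers; evenness lets a sign pass
    through the mutation formula. *)
Lemma half_mutation_exact (a b : int) : exists k, `|a| * b + a * `|b| = k * 2.
Proof.
have [a0|a0] := leP 0 a; have [b0|b0] := leP 0 b.
- by exists (a * b); rewrite !ger0_norm //; ring.
- by exists 0; rewrite ger0_norm // ltr0_norm //; ring.
- by exists 0; rewrite ltr0_norm // ger0_norm //; ring.
- by exists (- (a * b)); rewrite !ltr0_norm //; ring.
Qed.

Section Twin.
Variables (F F' : fieldType) (ch : [pchar F] =i pred0) (ch' : [pchar F'] =i pred0).
Variables (n m n' m' : nat) (phi : {rmorphism F -> F'}).
Variables (g : 'I_n -> 'I_n') (e : 'I_(n + m) -> 'I_(n' + m')).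
Variable eps : 'I_n -> int.
Hypothesis e_bij : bijective e.
Hypothesis e_lshift : forall x, e (lshift m x) = lshift m' (g x).
Hypothesis eps_sign : forall x, eps x = 1 \/ eps x = -1.
Implicit Types (D : seed_data F n m) (E : seed_data F' n' m').

(* The exchange matrices agree up to a sign which is constant on the connected
   components of the principal part. *)
Definition twin D E : Prop :=
  [/\ forall t, var E (e t) = phi (var D t),
      forall x t, exmx E (g x) (e t) = eps x * exmx D x t
    & forall x z, exmx D x (lshift m z) != 0 -> eps x = eps z].

Let e_inj : injective e := bij_inj e_bij.

Lemma twin_exchange D E x : twin D E -> exchange E (g x) = phi (exchange D x).
Proof.
move=> [vE bE _]; rewrite (exchangeE ch) (exchangeE ch') rmorphM fmorphV -e_lshift vE.
congr (_ * _); rewrite (peval_exch_poly_reindex ch' _ _ e_bij) (fmorph_peval ch ch').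
have -> : exch_poly (exmx E (g x) \o e) = exch_poly (exmx D x).
  case: (eps_sign x) => ex; [congr exch_poly|rewrite -[RHS]exch_polyN; congr exch_poly];
  by apply/funext => t /=; rewrite bE ex ?mul1r ?mulN1r.
by apply: eq_peval => t /=; rewrite vE.
Qed.

Lemma twin_mutate_at D E x : twin D E -> twin (mutate_at D x) (mutate_at E (g x)).
Proof.
move=> tw; have [vE bE bN] := tw; split=> [t|y t|y z] /=.
- by rewrite -e_lshift (inj_eq e_inj); case: ifP => // _; rewrite (twin_exchange _ tw).
- rewrite !mxE -e_lshift (inj_eq e_inj).
  have -> : (g y == g x) = (y == x).
    by rewrite -(inj_eq (@lshift_inj _ m')) -!e_lshift (inj_eq e_inj) (inj_eq (@lshift_inj _ _)).
  case: ifP => _; first by rewrite bE mulrN.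
  rewrite !bE mulrDr; congr (_ + _).
  (* The correction vanishes unless the entry at [y], [x] is nonzero; then both rows carry the same
     sign, which factors out. *)
  have [byx|/bN eq_eps] := eqVneq (exmx D y (lshift m x)) 0.
    by rewrite byx !mulr0 normr0 !mul0r addr0 div0z mulr0.
  rewrite -eq_eps; have [k kE] := half_mutation_exact (exmx D y (lshift m x)) (exmx D x t).
  case: (eps_sign y) => ->; rewrite ?mul1r // !mulN1r !normrN mulrN mulNr -opprD kE.
  by rewrite -mulNr !mulzK.
(* A nonzero new entry requires the old entry, or both factors through [x], to be nonzero; in the
   latter case the sign passes from [y] to [x] to [z]. *)
- rewrite !mxE; case: ifP => _; first by rewrite oppr_eq0 => /bN.
  have [//|/bN//] := eqVneq (exmx D y (lshift m z)) 0 => ->; rewrite add0r.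
  have [->|/bN ->] := eqVneq (exmx D y (lshift m x)) 0.
    by rewrite normr0 !mul0r addr0 div0z eqxx.
  have [->|/bN -> //] := eqVneq (exmx D x (lshift m z)) 0.
  by rewrite normr0 !mulr0 addr0 div0z eqxx.
Qed.

Lemma twin_foldl D E s : twin D E ->
  twin (foldl (@mutate_at F n m) D s) (foldl (@mutate_at F' n' m') E (map g s)).
Proof. by elim: s D E => //= x s IH D E /(twin_mutate_at x)/IH. Qed.

Hypothesis g_bij : bijective g.

(** Surjectivity of [g] prevents [E] from having an exchangeable variable equal to [phi y] when [D]
    has none equal to [y]. *)
Lemma twin_exch_index D E y : nondegenerate D -> twin D E ->
  exch_index E (phi y) = omap g (exch_index D y).
Proof.
move=> ndD tw; have [vE _ _] := tw; have [g' g'K gK] := g_bij.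
have v'E x : (var E (lshift m' (g x)) == phi y) = (var D (lshift m x) == y).
  by rewrite -e_lshift vE (inj_eq (fmorph_inj phi)).
rewrite {1}/exch_index; case: pickP => [x'|none].
  rewrite -{1}[x']gK v'E => /eqP <-.
  by rewrite (exch_index_var ch) //= gK.
rewrite /exch_index; case: pickP => // x; rewrite -v'E.
by rewrite none.
Qed.

Lemma twin_mutate_vars D E ys z : nondegenerate D -> twin D E ->
  mutate_vars E (map phi ys) (phi z) = phi (mutate_vars D ys z).
Proof.
elim: ys D E z => [//|y ys IH] D E z ndD tw /=.
rewrite /mutate /mutate_var (twin_exch_index _ ndD tw).
case: (exch_index D y) => [x|] /=; last exact: IH.
rewrite -(IH _ (mutate_at E (g x))); last exact: twin_mutate_at.
  by rewrite (inj_eq (fmorph_inj phi)) (fun_if phi) (twin_exchange _ tw).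
exact: nondegenerate_mutate_at.
Qed.

End Twin.

Lemma seed_nondegenerate (S : seed) : nondegenerate S.
Proof. by split; [exact: seed_independent | exact: seed_tsss]. Qed.

Lemma in_cluster_algebra_var (S : seed) t : in_cluster_algebra S (var S t).
Proof.
by case: (split_ordP t) => i ->; [exact: (ica_cluster S [::]) | exact: ica_frozen].
Qed.

Definition cluster_var (S : seed) t : cluster_algebra S :=
  Sub (var S t) (asboolT (in_cluster_algebra_var t)).

Lemma val_cluster_var (S : seed) t : val (@cluster_var S t) = var S t.
Proof. by rewrite SubK. Qed.

Lemma cluster_algebraP S (a : cluster_algebra S) : in_cluster_algebra S (val a).
Proof. exact/asboolP/(valP a). Qed.

Lemma cluster_algebra_lift (S : seed) z :
  in_cluster_algebra S z -> exists a : cluster_algebra S, val a = z.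
Proof. by move=> z_ca; exists (Sub z (asboolT z_ca)); rewrite SubK. Qed.

(** Pairs in one row are adjacent, so the products of corresponding entries never have opposite
    signs along a row. *)
Lemma seed_hom_sign (S S' : seed) (f : seed_hom S S') : is_seed_iso f ->
  exists eps : 'I_(rank S) -> int,
    [/\ forall x, eps x = 1 \/ eps x = -1,
        forall x t, exmx S' (shom_exch f x) (shom_ext f t) = eps x * exmx S x t
      & forall x z, exmx S x (lshift _ z) != 0 -> eps x = eps z].
Proof.
case=> _ _ absE.
pose b' x t := exmx S' (shom_exch f x) (shom_ext f t).
(* A row without a negative product, in particular a zero row, gets the sign 1. *)
pose eps x : int := if [exists t, b' x t * exmx S x t < 0] then -1 else 1.
have eps_sign x : eps x = 1 \/ eps x = -1 by rewrite /eps; case: ifP; [right | left].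
have bE x t : b' x t = eps x * exmx S x t.
  have := absE x t; rewrite -/(b' x t) /eps; case: existsP => [[s neg]|nneg].
    have [pos _] := shom_adjacent f t s (or_intror (erefl x)).
    rewrite -/(b' x t) -/(b' x s) in pos; move: pos neg.
    move: (b' x s * exmx S x s) => k pos neg.
    have {pos neg} : b' x t * exmx S x t <= 0 by rewrite -(nmulr_lge0 _ neg).
    move: (b' x t) (exmx S x t) => u v; nia.
  have : 0 <= b' x t * exmx S x t by rewrite leNgt; apply/negP => neg; apply: nneg; exists t.
  move: (b' x t) (exmx S x t) => u v; nia.
exists eps; split=> // x z bxz.
have bzx : exmx S z (lshift _ x) != 0.
  have := tsss_sign_skew x z (@seed_tsss S) => /= -[[bxz0 _]|]; first by rewrite bxz0 eqxx in bxz.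
  by apply: contraTneq => ->; rewrite mulr0 ltxx.
(* Adjacency of [(x, z)] and [(z, x)], both with nonzero entries, compares the signs of the two
   rows. *)
have [+ _] := shom_adjacent f (lshift _ z) (lshift _ x) (or_introl bxz).
rewrite -/(b' x _) -/(b' z _) !bE; move: bxz bzx.
move: (exmx S x _) (exmx S z _) => u v u0 v0.
by case: (eps_sign x) => ->; case: (eps_sign z) => -> //; nia.
Qed.

Lemma Seed_iso_Clus_iso (S S' : seed) : Seed_iso S S' -> Clus_iso S S'.
Proof.
case=> f f_iso; have [eps [eps_sign bE epsE]] := seed_hom_sign f_iso.
case: f_iso => g_bij e_bij _; have e_lshift := shom_extE f.
move: (shom_exch f) (shom_ext f) g_bij e_bij e_lshift bE => g e g_bij e_bij e_lshift bE.
have ch := @ambient_pchar0 S; have ch' := @ambient_pchar0 S'.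
have [phi phiE] := generic_field_hom ch (@seed_independent S) ch'
  (alg_independent_comp ch' (@seed_independent S') (bij_inj e_bij)) (@seed_generates S).
have tw : twin phi g e eps S S' by split=> // t; rewrite phiE.
have twf s := twin_foldl ch ch' e_bij e_lshift eps_sign s tw.
have [g' g'K gK] := g_bij; have [e' e'K eK] := e_bij.
(* Mutated seeds stay twins, so [phi] sends each generating variable to a variable of a seed mutated
   from [S']. *)
have phi_ca z : in_cluster_algebra S z -> in_cluster_algebra S' (phi z).
  elim=> {z} [j|s x||z z' _ IHz _ IHz'|z z' _ IHz _ IHz'].
  - by rewrite phiE; exact: in_cluster_algebra_var.
  - have [vE _ _] := twf s; rewrite -vE e_lshift; exact: ica_cluster.
  - by rewrite rmorph1; exact: ica_one.
  - by rewrite rmorphB; exact: ica_sub.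
  - by rewrite rmorphM; exact: ica_mul.
have phi_surj z' : in_cluster_algebra S' z' -> exists2 z, in_cluster_algebra S z & phi z = z'.
  elim=> {z'} [j|s x||z z' _ [y ? <-] _ [y' ? <-]|z z' _ [y ? <-] _ [y' ? <-]].
  - exists (var S (e' (rshift _ j))); first exact: in_cluster_algebra_var.
    by rewrite phiE /= eK.
  - exists (var (foldl (@mutate_at _ _ _) S (map g' s)) (lshift _ (g' x))).
      exact: ica_cluster.
    have [<- _ _] := twf (map g' s); rewrite e_lshift gK -map_comp.
    by rewrite (eq_map (_ : g \o g' =1 id)) ?map_id // => i /=; rewrite gK.
  - by exists 1; [exact: ica_one | rewrite rmorph1].
  - by exists (y - y'); [exact: ica_sub | rewrite rmorphB].
  - by exists (y * y'); [exact: ica_mul | rewrite rmorphM].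
pose h (a : cluster_algebra S) : cluster_algebra S' :=
  Sub (phi (val a)) (asboolT (phi_ca _ (cluster_algebraP a))).
have val_h a : val (h a) = phi (val a) by rewrite SubK.
have h_zmod : zmod_morphism h by move=> a b; apply: val_inj; rewrite rmorphB !val_h rmorphB.
have h_monoid : monoid_morphism h.
  by split=> [|a b]; apply: val_inj; rewrite ?rmorph1 ?rmorphM !val_h ?rmorph1 ?rmorphM.
pose hR : {rmorphism cluster_algebra S -> cluster_algebra S'} :=
  HB.pack h (GRing.isZmodMorphism.Build _ _ h h_zmod)
    (GRing.isMonoidMorphism.Build _ _ h h_monoid).
have val_hR a : val (hR a) = phi (val a) by exact: val_h.
exists hR; split.
- split=> [a /codomP[t aE]|a /codomP[x aE]|ys y a _ _ aE].
  + by left; rewrite val_hR aE phiE; apply/codomP; exists (e t).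
  + by left; rewrite val_hR aE phiE /= e_lshift; apply/codomP; exists (g x).
  + rewrite !val_hR aE; have -> : map (fun y => val (hR y)) ys = map phi (map val ys).
      by rewrite -map_comp; apply: eq_map => b; rewrite val_hR.
    by rewrite (twin_mutate_vars ch ch' e_bij e_lshift eps_sign g_bij _ _ (seed_nondegenerate S) tw).
- by move=> a b /(congr1 val); rewrite !val_hR => /fmorph_inj/val_inj.
- move=> b; have [z /cluster_algebra_lift[a <-] aE] := phi_surj _ (cluster_algebraP b).
  by exists a; apply: val_inj; rewrite val_hR.
Qed.

(** * Evaluation at a point where one frozen variable vanishes *)

Section RegularAt.
Variables (F : fieldType) (ch : [pchar F] =i pred0) (N : nat) (v : 'I_N -> F).
Variable u : 'I_N -> rat.
Hypothesis indep : alg_independent v.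
Let chQ : [pchar rat] =i pred0 := @pchar_num rat.

(* z, seen as a rational function of v, is defined at u and takes the value c. *)
Definition regular_at (z : F) (c : rat) : Prop := exists p q,
  [/\ peval chQ u q != 0, z = peval ch v p / peval ch v q
    & c = peval chQ u p / peval chQ u q].

Let denom_neq0 q : peval chQ u q != 0 -> peval ch v q != 0.
Proof. by apply: contraNneq => /indep ->; rewrite rmorph0. Qed.

Lemma regular_at_unique z c d : regular_at z c -> regular_at z d -> c = d.
Proof.
move=> [p [q [q0 -> ->]]] [r [s [s0 /eqP + ->]]].
rewrite eqr_div ?denom_neq0 // -!rmorphM => /eqP/(peval_inj indep) eq_pq.
by apply/eqP; rewrite eqr_div // -!rmorphM eq_pq.
Qed.

Lemma regular_at_const k : regular_at (ratr k) k.
Proof.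
exists k%:MP, 1; rewrite !rmorph1 !divr1 oner_eq0 !pevalC; split=> //.
by rewrite -(fmorph_eq_rat idfun).
Qed.

Lemma regular_at_var t : regular_at (v t) (u t).
Proof. by exists 'X_t, 1; rewrite !rmorph1 !divr1 oner_eq0 !pevalXU. Qed.

Lemma regular_atD z z' c c' :
  regular_at z c -> regular_at z' c' -> regular_at (z + z') (c + c').
Proof.
move=> [p [q [q0 -> ->]]] [r [s [s0 -> ->]]]; exists (p * s + r * q), (q * s).
by rewrite !rmorphD !rmorphM mulf_neq0 // !addf_div ?denom_neq0.
Qed.

Lemma regular_atM z z' c c' :
  regular_at z c -> regular_at z' c' -> regular_at (z * z') (c * c').
Proof.
move=> [p [q [q0 -> ->]]] [r [s [s0 -> ->]]]; exists (p * r), (q * s).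
by rewrite !rmorphM mulf_neq0 // !mulf_div.
Qed.

Lemma regular_atV z c : c != 0 -> regular_at z c -> regular_at z^-1 c^-1.
Proof.
move=> c0 [p [q [q0 -> cE]]]; exists q, p; rewrite cE !invf_div; split=> //.
by move: c0; rewrite cE mulf_eq0 negb_or => /andP[].
Qed.

Lemma regular_at_peval M (w : 'I_M -> F) (k : 'I_M -> rat) p :
  (forall t, regular_at (w t) (k t)) -> regular_at (peval ch w p) (peval chQ k p).
Proof.
move=> wk; elim/mpolyind: p => [|c m p _ _ IH].
  rewrite !rmorph0; have := regular_at_const 0.
  by rewrite -[ratr 0]/(pchar0_ratr ch 0) rmorph0.
rewrite !rmorphD; apply: regular_atD => //; rewrite -mul_mpolyC !rmorphM.
apply: regular_atM.
  by rewrite !pevalC -[X in regular_at _ X](fmorph_eq_rat idfun); exact: regular_at_const.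
have one : regular_at 1 1.
  by have := regular_at_const 1; rewrite -[ratr 1]/(pchar0_ratr ch 1) rmorph1.
rewrite !pevalX; elim/big_ind2: _ => [|? ? ? ? ? ?|t _] //; first exact: regular_atM.
by elim: (m t) => [|d IHd]; rewrite ?expr0 // !exprS; exact: regular_atM.
Qed.

End RegularAt.

(** Since [b y] and [- b y] are not both positive, one of the monomials omits [y] and is positive;
    the other is nonnegative. *)
Lemma exch_poly_gt0 N (k : 'I_N -> rat) (b : 'I_N -> int) y :
  0 <= k y -> (forall t, t != y -> 0 < k t) ->
  0 < peval (@pchar_num rat) k (exch_poly b).
Proof.
move=> ky kt; have k_ge0 t : 0 <= k t by have [->//|/kt/ltW] := eqVneq t y.
have ge0 c : 0 <= peval (@pchar_num rat) k 'X_[pos_mnm c].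
  by rewrite pevalX; apply: prodr_ge0 => t _; exact: exprn_ge0.
have gt0 c : c y <= 0 -> 0 < peval (@pchar_num rat) k 'X_[pos_mnm c].
  move=> cy; rewrite pevalX; apply: prodr_gt0 => t _; rewrite mnmE.
  by case: (ltrP 0 (c t)) => // ct; apply: exprn_gt0; apply: kt; apply: contraTneq ct => ->; rewrite -leNgt.
rewrite rmorphD; have [/gt0 by_le0|/ltW by_ge0] := leP (b y) 0.
  exact: ltr_pwDl.
by rewrite addrC; apply: ltr_pwDl => //; apply: gt0; rewrite oppr_le0.
Qed.

(* Cluster variables are subtraction-free in the initial ones, and the two
   monomials of an exchange relation have no common variable; hence they stay
   finite and positive where a single frozen variable vanishes. *)
Lemma regular_at_cluster_algebra (S : seed) (j : 'I_(nfrozen S)) z :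
  in_cluster_algebra S z -> exists c,
  regular_at (@ambient_pchar0 S) (var S) (fun t => (t != rshift _ j)%:R) z c.
Proof.
pose u t : rat := (t != rshift (rank S) j)%:R; rewrite -/u; have indep := @seed_independent S.
pose ch := @ambient_pchar0 S.
(* Invariant along mutation sequences: the values are nonnegative at the distinguished frozen index
   and positive elsewhere. *)
have reg_foldl s : exists k : 'I_(rank S + nfrozen S) -> rat,
    [/\ forall t, regular_at ch (var S) u (var (foldl (@mutate_at _ _ _) S s) t) (k t),
        0 <= k (rshift _ j) & forall t, t != rshift _ j -> 0 < k t].
  elim/last_ind: s => [|s x [k [reg ky kt]]].
    exists u; split=> [t||t]; [exact: regular_at_var | exact: ler0n |].
    by rewrite /u => ->.
  rewrite -cats1 foldl_cat /=; set D := foldl _ _ _ in reg *.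
  have kx : 0 < k (lshift _ x) by apply: kt; rewrite eq_lrshift.
  have kM := exch_poly_gt0 (exmx D x) ky kt.
  exists (fun t => if t == lshift _ x then
     (k (lshift _ x))^-1 * peval (@pchar_num rat) k (exch_poly (exmx D x)) else k t).
  split=> [t||t ty].
  - case: ifP => _; last exact: reg.
    rewrite (exchangeE ch); apply: regular_atM => //; last exact: regular_at_peval.
    by apply: regular_atV; rewrite ?gt_eqF.
  - by rewrite eq_rlshift.
  - by case: ifP => _; rewrite ?kt // mulr_gt0 ?invr_gt0.
elim=> {z} [i|s x||z z' _ [c cz] _ [c' cz']|z z' _ [c cz] _ [c' cz']].
- by exists (u (rshift _ i)); exact: regular_at_var.
- by have [k [reg _ _]] := reg_foldl s; exists (k (lshift _ x)); exact: reg.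
- by exists 1; have := regular_at_peval indep 1 (regular_at_var ch (var S) u); rewrite !rmorph1.
- exists (c + (-1) * c'); rewrite -[- z']mulN1r; apply: regular_atD => //.
  apply: regular_atM => //.
  by have := regular_at_peval indep (-1) (regular_at_var ch (var S) u); rewrite !rmorphN1.
- by exists (c * c'); exact: regular_atM.
Qed.

(** * From isomorphisms of rooted cluster algebras to seed isomorphisms *)

(** The exchange binomial with natural exponents makes sense inside the cluster algebra, where
    variables need not be invertible. *)
Definition exch_sum (R : comNzRingType) N (b : 'I_N -> int) (c : 'I_N -> R) : R :=
  \prod_(t | 0 < b t) c t ^+ `|b t|%N + \prod_(t | b t < 0) c t ^+ `|b t|%N.

Lemma rmorph_exch_sum (R K : comNzRingType) (h : {rmorphism R -> K}) N b (c : 'I_N -> R) :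
  h (exch_sum b c) = exch_sum b (h \o c).
Proof.
by rewrite rmorphD !rmorph_prod; congr (_ + _); apply: eq_bigr => t _; rewrite rmorphXn.
Qed.

Lemma exchange_var (F : fieldType) n m (D : seed_data F n m) x :
  var D (lshift m x) != 0 -> exchange D x * var D (lshift m x) = exch_sum (exmx D x) (var D).
Proof.
move=> x0; rewrite mulrC mulVKf //; congr (_ + _); apply: eq_bigr => t bt.
  by rewrite -{1}[exmx D x t]gez0_abs ?ltW.
by rewrite -abszN -{1}[- exmx D x t]gez0_abs // oppr_ge0 ltW.
Qed.

Lemma in_cluster_algebra_foldl (S : seed) s t :
  in_cluster_algebra S (var (foldl (@mutate_at _ _ _) S s) t).
Proof.
case: (split_ordP t) => i -> {t}; first exact: ica_cluster.
suff -> : var (foldl (@mutate_at _ _ _) S s) (rshift (rank S) i) = var S (rshift (rank S) i).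
  exact: ica_frozen.
by elim/last_ind: s => // s x IH; rewrite -cats1 foldl_cat /= eq_rlshift.
Qed.

(** The exchange relation, written without division, holds inside the algebra, so [f] respects it;
    cancelling in the target field determines [f] on each new variable. *)
Lemma ring_hom_eq_field_hom (S S' : seed)
    (f : {rmorphism cluster_algebra S -> cluster_algebra S'})
    (phi : {rmorphism ambient S -> ambient S'}) :
  (forall t, val (f (cluster_var t)) = phi (var S t)) ->
  forall a, val (f a) = phi (val a).
Proof.
move=> f_var; have f_foldl s t : exists2 a : cluster_algebra S,
    val a = var (foldl (@mutate_at _ _ _) S s) t & val (f a) = phi (val a).
  elim/last_ind: s t => [|s x IH] t.
    by exists (cluster_var t); rewrite ?f_var val_cluster_var.
  pose z := var (foldl (@mutate_at _ _ _) S (rcons s x)) t.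
  have [a aE] := cluster_algebra_lift (in_cluster_algebra_foldl (rcons s x) t).
  exists a => //; rewrite aE /z.
  have [indep _] := nondegenerate_foldl (@ambient_pchar0 S) s (seed_nondegenerate S).
  move: aE; rewrite /z -cats1 foldl_cat /=.
  set D := foldl _ _ _ in IH indep *; case: ifP => [_ aE|_ aE]; last first.
    have [b bE fb] := IH t; rewrite -bE -fb; congr (val (f _)).
    by apply: val_inj; rewrite bE; exact: aE.
  have /choice[c cE] : forall t, exists a : cluster_algebra S,
    val a = var D t /\ val (f a) = phi (var D t).
    by move=> t'; have [b bE fb] := IH t'; exists b; rewrite -bE.
  have x0 := alg_independent_var_neq0 (@ambient_pchar0 S) indep (lshift (nfrozen S) x).
  have acE : a * c (lshift _ x) = exch_sum (exmx D x) c.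
    apply: val_inj; rewrite rmorphM rmorph_exch_sum /= aE (cE _).1 exchange_var //.
    by congr exch_sum; apply/funext => t'; rewrite /= (cE _).1.
  have fM : val (f (exch_sum (exmx D x) c)) = phi (exch_sum (exmx D x) (var D)).
    by rewrite !rmorph_exch_sum; congr exch_sum; apply/funext => t' /=; rewrite (cE _).2.
  move: fM; rewrite -acE -(exchange_var x0) !rmorphM /= (cE _).2 => /mulIf; apply.
  by rewrite fmorph_eq0.
suff f_ca z : in_cluster_algebra S z -> exists2 a : cluster_algebra S,
    val a = z & val (f a) = phi (val a).
  move=> a; have [b bE fb] := f_ca _ (cluster_algebraP a).
  by rewrite -bE -fb; congr (val (f _)); apply: val_inj.
elim=> {z} [j|s x||z z' _ [a <- aE] _ [a' <- a'E]|z z' _ [a <- aE] _ [a' <- a'E]].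
- exact: (f_foldl [::]).
- exact: f_foldl.
- by exists 1; rewrite !rmorph1.
- by exists (a - a'); rewrite !rmorphB //= aE a'E.
- by exists (a * a'); rewrite !rmorphM //= aE a'E.
Qed.

Lemma inj_surj_bijective (T U : Type) (h : T -> U) :
  injective h -> (forall y, exists x, h x = y) -> bijective h.
Proof. by move=> h_inj /choice[k kK]; exists k => // x; apply: h_inj. Qed.

Section ClusIsoToSeedIso.
Variables S S' : seed.
Variable f : {rmorphism cluster_algebra S -> cluster_algebra S'}.
Hypothesis f_morph : rooted_cluster_morphism f.
Hypothesis f_inj : injective f.
Hypothesis f_surj : forall b, exists a, f a = b.

Let ch := @ambient_pchar0 S.
Let ch' := @ambient_pchar0 S'.
Let indep := @seed_independent S.
Let indep' := @seed_independent S'.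
Let var_inj' := alg_independent_var_inj ch' indep'.

Let f_var_not_int t (k : int) : val (f (cluster_var t)) <> k%:~R.
Proof.
move=> fk; apply: (alg_independent_var_neq_int ch indep (i := t) (k := k)).
rewrite -val_cluster_var; have -> : cluster_var t = k%:~R; last by rewrite rmorph_int.
by apply/f_inj/val_inj; rewrite fk !rmorph_int.
Qed.

Lemma rooted_iso_induced_maps : exists (g : 'I_(rank S) -> 'I_(rank S'))
    (e : 'I_(rank S + nfrozen S) -> 'I_(rank S' + nfrozen S')),
  [/\ forall t, val (f (cluster_var t)) = var S' (e t), injective e
    & forall x, e (lshift _ x) = lshift _ (g x)].
Proof.
have /choice[e eE] : forall t, exists s, val (f (cluster_var t)) = var S' s.
  move=> t; have [|/codomP[s sE]|[k /f_var_not_int//]] := CM1 f_morph (x := cluster_var t).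
    by rewrite val_cluster_var codom_f.
  by exists s.
have /choice[g gE] : forall x, exists x',
    val (f (cluster_var (lshift _ x))) = var S' (lshift _ x').
  move=> x; have [|/codomP[y yE]|[k /f_var_not_int//]] :=
    CM2 f_morph (x := cluster_var (lshift _ x)).
    by rewrite val_cluster_var; apply/codomP; exists x.
  by exists y.
exists g, e; split=> // [s t st|x]; last by apply: var_inj'; rewrite -gE eE.
apply: (alg_independent_var_inj ch indep); rewrite -!val_cluster_var; congr val.
by apply/f_inj/val_inj; rewrite !eE st.
Qed.

Variables (g : 'I_(rank S) -> 'I_(rank S')).
Variable (e : 'I_(rank S + nfrozen S) -> 'I_(rank S' + nfrozen S')).
Hypothesis f_var : forall t, val (f (cluster_var t)) = var S' (e t).
Hypothesis e_inj : injective e.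
Hypothesis e_lshift : forall x, e (lshift _ x) = lshift _ (g x).
Variable phi : {rmorphism ambient S -> ambient S'}.
Hypothesis phi_var : forall t, phi (var S t) = var S' (e t).

Let f_phi a : val (f a) = phi (val a).
Proof. by apply: ring_hom_eq_field_hom => t; rewrite f_var phi_var. Qed.

Let w_indep : alg_independent (var S' \o e) := alg_independent_comp ch' indep' e_inj.

Let phi_peval p : phi (peval ch (var S) p) = peval ch' (var S' \o e) p.
Proof.
by rewrite (fmorph_peval ch ch'); apply: eq_peval => t; exact: phi_var.
Qed.

(* A missing x'_s would be a rational function of the other variables. *)
Lemma rooted_iso_ext_surj s : exists t, e t = s.
Proof.
apply/not_existsP => s_notin.
have [a fa] := f_surj (cluster_var s).
have [p [q [q0 aE]]] := @seed_generates S (val a).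
have q_neq0 : peval ch' (var S' \o e) q != 0.
  by apply: contraNneq q0 => /w_indep ->; rewrite -(pevalE ch) rmorph0.
have rel : var S' s * peval ch' (var S' \o e) q = peval ch' (var S' \o e) p.
  rewrite -val_cluster_var -fa f_phi aE fmorph_div -!(pevalE ch) !phi_peval.
  by rewrite divfK.
have /(peval_inj indep') : peval ch' (var S') ('X_s * mrename e q) =
    peval ch' (var S') (mrename e p).
  by rewrite rmorphM pevalXU !peval_mrename.
(* Increasing [x'_s] by 1 leaves both renamed polynomials unchanged, so the denominator would have
   to vanish. *)
move/(congr1 (peval ch' (subst_at (var S') s (var S' s + 1)))).
rewrite rmorphM pevalXU !peval_mrename.
have eE : subst_at (var S') s (var S' s + 1) \o e =1 var S' \o e.
  by move=> t; rewrite /subst_at /=; case: eqP => // /s_notin.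
rewrite !(eq_peval ch' eE) -rel {1}/subst_at eqxx mulrDl mul1r => /eqP.
by rewrite -subr_eq0 addrAC subrr add0r (negbTE q_neq0).
Qed.

Let e_bij : bijective e := inj_surj_bijective e_inj rooted_iso_ext_surj.

Let var_exchange x' : exchange S' x' * var S' (lshift _ x') =
  phi (peval ch (var S) (exch_poly (exmx S' x' \o e))).
Proof.
rewrite (exchangeE ch') mulrAC mulVf ?mul1r; last exact: (alg_independent_var_neq0 ch' indep').
by rewrite (peval_exch_poly_reindex ch' _ _ e_bij) phi_peval.
Qed.

(* If x' came from a frozen y, the preimage of mu_{x'}(x') times y would be the
   exchange binomial of x'; evaluated where y vanishes and all other variables
   are 1, this reads 0 = 2. *)
Lemma rooted_iso_exch_surj x' : exists x, g x = x'.
Proof.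
have [t tE] := rooted_iso_ext_surj (lshift _ x').
case: (split_ordP t) tE => [x ->|j -> jE].
  by rewrite e_lshift => /lshift_inj; exists x.
have [b bE] := cluster_algebra_lift (ica_cluster S' [:: x'] x').
have [a fa] := f_surj b.
have aE : phi (val a) = exchange S' x' by rewrite -f_phi fa bE /= eqxx.
have aM : val a * var S (rshift _ j) = peval ch (var S) (exch_poly (exmx S' x' \o e)).
  by apply: (fmorph_inj phi); rewrite rmorphM aE phi_var jE var_exchange.
have [c ac] := regular_at_cluster_algebra j (cluster_algebraP a).
have := regular_atM ac (regular_at_var ch (var S) _ (rshift _ j)).
rewrite aM eqxx mulr0 /=.
(* The variable at [x'] does not occur in its own binomial, so setting [y] to 0 does not affect the
   value. *)
have row0 : (exmx S' x' \o e) (rshift _ j) = 0 by rewrite /= jE tsss_diag //; exact: seed_tsss.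
set u := (X in regular_at _ _ X); have u_var := regular_at_var ch (var S) u.
move=> /(regular_at_unique indep (regular_at_peval indep _ u_var)).
have -> : u = subst_at (fun=> 1) (rshift _ j) 0.
  by apply/funext => t'; rewrite /u /subst_at; case: eqP.
rewrite peval_exch_poly_subst // => /eqP; rewrite gt_eqF //.
exact: (@exch_poly_gt0 _ _ _ (rshift _ j)).
Qed.

Lemma rooted_iso_row x : exists2 eps : int, eps = 1 \/ eps = -1 &
  forall t, exmx S' (g x) (e t) = eps * exmx S x t.
Proof.
have x_cl : var S (lshift _ x) \in cluster S by apply/codomP; exists x.
have gx_cl : var S' (lshift _ (g x)) \in cluster S' by apply/codomP; exists (g x).
have [c [valc fc]] : exists c : cluster_algebra S,
    val c = var S (lshift _ x) /\ val (f c) = var S' (lshift _ (g x)).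
  by exists (cluster_var (lshift _ x)); rewrite f_var e_lshift val_cluster_var.
have [a aE] := cluster_algebra_lift (ica_cluster S [:: x] x).
(* CM3 for the one-step sequence in direction [x], applied to [x] itself. *)
have phi_exch : phi (exchange S x) = exchange S' (g x).
  have adm : biadmissible f [:: c].
    by rewrite /biadmissible /admissible !map_cons valc fc x_cl gx_cl.
  have c_ext : val c \in ext_cluster S by rewrite valc codom_f.
  have mE : mutate_vars S [:: val c] (val c) = exchange S x.
    by rewrite valc /= /mutate_var (exch_index_var ch _ (seed_nondegenerate S)) eqxx.
  have mE' : mutate_vars S' [:: val (f c)] (val (f c)) = exchange S' (g x).
    by rewrite fc /= /mutate_var (exch_index_var ch' _ (seed_nondegenerate S')) eqxx.
  have {}aE : val a = exchange S x by rewrite aE /= eqxx.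
  by rewrite -aE -f_phi -mE'; apply: (CM3 f_morph adm c_ext); rewrite aE -mE.
(* Multiplying by the exchanged variable leaves an equation between the two binomials. *)
have : phi (peval ch (var S) (exch_poly (exmx S x))) =
       phi (peval ch (var S) (exch_poly (exmx S' (g x) \o e))).
  rewrite -var_exchange -phi_exch -e_lshift -phi_var -rmorphM; congr (phi _).
  rewrite (exchangeE ch) mulrAC mulVf ?mul1r //.
  exact: (alg_independent_var_neq0 ch indep).
move/fmorph_inj/(peval_inj indep)/exch_poly_inj => [] rowE.
  by exists 1; [left | move=> t; rewrite mul1r rowE].
by exists (-1); [right | move=> t; rewrite mulN1r rowE opprK].
Qed.

Lemma rooted_iso_Seed_iso : Seed_iso S S'.
Proof.
have g_inj : injective g by move=> x y xy; apply/lshift_inj/e_inj; rewrite !e_lshift xy.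
have adjacent x y z w : exmx S x (lshift (nfrozen S) z) != 0 \/ x = z ->
    0 <= (exmx S' (g x) (e y) * exmx S x y) * (exmx S' (g z) (e w) * exmx S z w) /\
    `|exmx S x y| <= `|exmx S' (g x) (e y)|.
  have [ex ex1 rx] := rooted_iso_row x; have [ez ez1 rz] := rooted_iso_row z.
  move=> adj; have eq_eps : exmx S x y * exmx S z w = 0 \/ ex = ez.
    case: adj => [bxz|xz]; last first.
      (* Two sign choices for the same row can differ only where the entry is zero. *)
      subst z; have := rx y; rewrite rz.
      case: ex1 => ->; case: ez1 => ->; [by right|left|left|by right]; nia.
    (* The products of opposite entries are negative in both seeds, and they differ by the factor
       [ex * ez]. *)
    right; have /= [[b0 _]|] := tsss_sign_skew x z (@seed_tsss S); first by rewrite b0 eqxx in bxz.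
    have /= := tsss_sign_skew (g x) (g z) (@seed_tsss S').
    rewrite -!e_lshift rx rz.
    by case: ex1 => ->; case: ez1 => -> //; nia.
  rewrite rx rz; case: ex1 eq_eps => ->; case: ez1 => ->; nia.
exists (SeedHom e_lshift adjacent); split=> /= [||x y].
- exact: inj_surj_bijective g_inj rooted_iso_exch_surj.
- exact: e_bij.
- by have [eps [] -> ->] := rooted_iso_row x; rewrite ?mul1r ?mulN1r ?normrN.
Qed.

End ClusIsoToSeedIso.

Theorem proposition3p8 (S S' : seed) : Clus_iso S S' <-> Seed_iso S S'.
Proof.
split=> [[f [f_morph f_inj f_surj]]|]; last exact: Seed_iso_Clus_iso.
have [g [e [f_var e_inj e_lshift]]] := rooted_iso_induced_maps f_morph f_inj.
have [phi phi_var] := generic_field_hom (@ambient_pchar0 S) (@seed_independent S)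
  (@ambient_pchar0 S') (alg_independent_comp (@ambient_pchar0 S') (@seed_independent S') e_inj)
  (@seed_generates S).
exact: (rooted_iso_Seed_iso f_morph f_surj f_var e_inj e_lshift phi_var).
Qed.
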